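(* Let $N\ge 1$, let $H^\alpha:\mathbb{R}\to\mathbb{R}$, $\alpha=1,\dots,N$, be continuous and coercive ($H^\alpha(s)\to+\infty$ as $|s|\to+\infty$). Let $F_0:\mathbb{R}^N\to\mathbb{R}$ be continuous, nonincreasing in each of its arguments, and semi-coercive: $F_0(p)\to+\infty$ as $\min_{\alpha}p^\alpha\to-\infty$. Then $$\underline R F_0=F_0\underline G\qquad\text{and}\qquad \overline R F_0=F_0\overline G .$$
   Context: For $p,q\in\mathbb{R}^N$, $q\le p$ means $q^\alpha\le p^\alpha$ for all $\alpha$. $H_{\min}(p)=\min_\alpha H^\alpha(p^\alpha)$, $H_{\max}(p)=\max_\alpha H^\alpha(p^\alpha)$. The semi-relaxations are $$\underline R F_0(p)=\sup_{q\ge p}\min\{F_0(q),H_{\min}(q)\},\qquad \overline R F_0(p)=\inf_{q\le p}\max\{F_0(q),H_{\max}(q)\}.$$ The Godunov semi-fluxes are the set-valued maps (with values subsets of $[-\infty,+\infty]$), for real $q^\alpha,p^\alpha$, $$\underline G^\alpha(q^\alpha,p^\alpha)=\begin{cases}\{-\infty\}&q^\alpha<p^\alpha\\ [-\infty,H^\alpha(p^\alpha)]&q^\alpha=p^\alpha\\ \{\max_{[p^\alpha,q^\alpha]}H^\alpha\}&q^\alpha>p^\alpha\end{cases}\qquad \overline G^\alpha(q^\alpha,p^\alpha)=\begin{cases}\{\min_{[q^\alpha,p^\alpha]}H^\alpha\}&q^\alpha<p^\alpha\\ [H^\alpha(p^\alpha),+\infty]&q^\alpha=p^\alpha\\ \{+\infty\}&q^\alpha>p^\alpha.\end{cases}$$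 For $p\in\mathbb{R}^N$, $(F_0\underline G)(p)$ (resp. $(F_0\overline G)(p)$) denotes the value $F_0(q)$ for any $q\in\mathbb{R}^N$ such that $F_0(q)\in\underline G^\alpha(q^\alpha,p^\alpha)$ (resp. $F_0(q)\in\overline G^\alpha(q^\alpha,p^\alpha)$) for all $\alpha=1,\dots,N$; under the stated assumptions such a $q$ exists and the value $F_0(q)$ does not depend on the choice of $q$. *)

(* Defs.v *)
From HB Require Import structures.
From mathcomp Require Import all_boot all_order all_algebra.
From mathcomp Require Import all_classical all_reals all_analysis.

Set Implicit Arguments.
Unset Strict Implicit.
Unset Printing Implicit Defensive.

Import Order.TTheory GRing.Theory Num.Theory.
Import numFieldNormedType.Exports.

Local Open Scope classical_set_scope.
Local Open Scope ring_scope.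

(* Points of R^N are row vectors; the coordinate p^alpha is [p ord0 a]. *)

Definition le_vec (R : realType) (N : nat) (q p : 'rV[R]_N) : Prop :=
  forall a : 'I_N, q ord0 a <= p ord0 a.

(* Minima and maxima over the coordinates are taken in [\bar R], with neutral
   elements +oo and -oo; for N >= 1 they are the usual real numbers. *)
Definition coord_min (R : realType) (N : nat) (x : 'I_N -> R) : \bar R :=
  \big[Order.min/+oo%E]_(a < N) (x a)%:E.

Definition coord_max (R : realType) (N : nat) (x : 'I_N -> R) : \bar R :=
  \big[Order.max/-oo%E]_(a < N) (x a)%:E.

Definition Hmin (R : realType) (N : nat) (H : 'I_N -> R -> R)
    (p : 'rV[R]_N) : \bar R :=
  coord_min (fun a => H a (p ord0 a)).

Definition Hmax (R : realType) (N : nat) (H : 'I_N -> R -> R)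
    (p : 'rV[R]_N) : \bar R :=
  coord_max (fun a => H a (p ord0 a)).

Definition coercive (R : realType) (h : R -> R) : Prop :=
  forall A : R, exists B : R, forall s : R, B < `|s| -> A < h s.

Definition semi_coercive (R : realType) (N : nat) (F : 'rV[R]_N -> R) : Prop :=
  forall A : R, exists B : R, forall p : 'rV[R]_N,
    (coord_min (fun a => p ord0 a) < B%:E)%E -> A < F p.

Definition nonincreasing_each (R : realType) (N : nat)
    (F : 'rV[R]_N -> R) : Prop :=
  forall (a : 'I_N) (p q : 'rV[R]_N),
    (forall b : 'I_N, b != a -> p ord0 b = q ord0 b) ->
    p ord0 a <= q ord0 a -> F q <= F p.

Definition lower_relax (R : realType) (N : nat) (H : 'I_N -> R -> R)
    (F : 'rV[R]_N -> R) (p : 'rV[R]_N) : \bar R :=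
  ereal_sup [set Order.min (F q)%:E (Hmin H q) | q in [set q | le_vec p q]].

Definition upper_relax (R : realType) (N : nat) (H : 'I_N -> R -> R)
    (F : 'rV[R]_N -> R) (p : 'rV[R]_N) : \bar R :=
  ereal_inf [set Order.max (F q)%:E (Hmax H q) | q in [set q | le_vec q p]].

(* The singleton {max_A h} (resp. {min_A h}) when the extremum is attained. *)
Definition max_on (R : realType) (h : R -> R) (A : set R) : set (\bar R) :=
  [set (h s)%:E | s in [set s | A s /\ forall t : R, A t -> h t <= h s]].

Definition min_on (R : realType) (h : R -> R) (A : set R) : set (\bar R) :=
  [set (h s)%:E | s in [set s | A s /\ forall t : R, A t -> h s <= h t]].

Definition lower_godunov (R : realType) (h : R -> R) (q p : R)
    : set (\bar R) :=
  if q < p then [set -oo%E]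
  else if q == p then [set y | (y <= (h p)%:E)%E]
  else max_on h `[p, q].

Definition upper_godunov (R : realType) (h : R -> R) (q p : R)
    : set (\bar R) :=
  if q < p then min_on h `[q, p]
  else if q == p then [set y | ((h p)%:E <= y)%E]
  else [set +oo%E].

(* All the values F(q) admissible in the definition of (F G)(p).  That (F G)(p)
   is well defined and equal to v is the statement that this set is [set v]. *)
Definition godunov_values (R : realType) (N : nat)
    (G : 'I_N -> R -> R -> set (\bar R)) (F : 'rV[R]_N -> R)
    (p : 'rV[R]_N) : set (\bar R) :=
  [set (F q)%:E | q in
    [set q : 'rV[R]_N | forall a : 'I_N, G a (q ord0 a) (p ord0 a) (F q)%:E]].

(* Main.v *)
(* If [q] is admissible for the lower Godunov flux at [p], then any [q' >= p]
   either dominates [q], so that [F0 q' <= F0 q], or has a coordinate in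
   [p^a, q^a[, where [H^a <= F0 q]; and choosing in each [p^a, q^a] a point with
   [H^a >= F0 q] shows that the supremum is reached.  Existence of [q] follows
   from the intermediate value theorem between the extreme points at which the
   running maxima of the [H^a] take the value of the supremum.  The upper
   statement is the lower one for [- H^a (- x)] and [- F0 (- q)], with the
   coercivity of the Hamiltonians replaced by the semi-coercivity of [F0]. *)
Require Import Defs.
From HB Require Import structures.
From mathcomp Require Import all_boot all_order all_algebra.
From mathcomp Require Import all_classical all_reals all_analysis.
From mathcomp Require Import lra.

Set Implicit Arguments.
Unset Strict Implicit.
Unset Printing Implicit Defensive.

Import Order.TTheory GRing.Theory Num.Theory.
Import numFieldNormedType.Exports.


Local Open Scope classical_set_scope.
Local Open Scope ring_scope.

(** * Neighbourhoods, monotonicity and levels on a half-line *)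

Lemma ball_gt (R : realType) (T : pseudoMetricType R) (f : T -> R) (x : T)
    (l : R) :
  {for x, continuous f} -> l < f x ->
  exists2 e : R, 0 < e & forall y, ball x e y -> l < f y.
Proof.
move=> fx lf; have : \forall y \near x, l < f y by exact: (cvgr_gt (f x)).
by case/nbhs_ballP => e /= e0 xe; exists e.
Qed.

Lemma ball_lt (R : realType) (T : pseudoMetricType R) (f : T -> R) (x : T)
    (l : R) :
  {for x, continuous f} -> f x < l ->
  exists2 e : R, 0 < e & forall y, ball x e y -> f y < l.
Proof.
move=> fx lf; have : \forall y \near x, f y < l by exact: (cvgr_lt (f x)).
by case/nbhs_ballP => e /= e0 xe; exists e.
Qed.

(** Pass from [p] to [q] one coordinate at a time: [r k] has its first [k] coordinates from [q] and
    the others from [p]. *)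
Lemma nonincreasing_le_vec (R : realType) (N : nat) (F : 'rV[R]_N -> R)
    (p q : 'rV[R]_N) :
  nonincreasing_each F -> le_vec p q -> F q <= F p.
Proof.
move=> Fni pq.
pose r k : 'rV[R]_N := \row_i (if (i < k)%N then q ord0 i else p ord0 i).
have rN : r N = q by apply/rowP => i; rewrite mxE ltn_ord.
have r0 : r 0%N = p by apply/rowP => i; rewrite mxE.
suff rk k : (k <= N)%N -> F (r k) <= F p by rewrite -rN rk.
elim: k => [|k IH] kN; first by rewrite r0.
apply: le_trans (IH (ltnW kN)).
apply: (Fni (Ordinal kN)) => [b bk|]; rewrite !mxE /= ?ltnn ?leqnn //.
by rewrite ltnS (leq_eqVlt b); move: bk; rewrite -val_eqE /= => /negbTE ->.
Qed.

Lemma nonincreasing_reflect (R : realType) (N : nat) (F : 'rV[R]_N -> R) :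
  nonincreasing_each F -> nonincreasing_each (fun q => - F (- q)).
Proof.
move=> Fni a p q pq pqa; rewrite lerN2; apply: (Fni a) => [b /pq|].
  by rewrite !mxE => ->.
by rewrite !mxE lerN2.
Qed.

(* [a] and [b] are the infima of [h >= l] and of [h > l] on [p, +oo[, so that
   [p, x] has maximum [l] exactly for the [x] in [a, b] (when [p < x]). *)
Lemma level_interval (R : realType) (h : R -> R) (p l : R) :
  continuous h -> (exists2 x, p <= x & l < h x) ->
  exists a b : R, [/\ p <= a <= b, l <= h a,
    forall x, p <= x < a -> h x < l,
    p < b -> forall x, p <= x <= b -> h x <= l &
    forall e, 0 < e -> exists2 x, b <= x < b + e & l < h x].
Proof.
move=> hc [x0 px0 lx0].
pose A := [set x | p <= x /\ l <= h x]; pose B := [set x | p <= x /\ l < h x].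
have infA : has_inf A.
  by split; [exists x0; split => //; exact: ltW | exists p => x []].
have infB : has_inf B by split; [exists x0 | exists p => x []].
have pA : p <= inf A by apply: lb_le_inf; [exact: infA.1 | move=> x []].
have hB x : p <= x -> x < inf B -> h x <= l.
  move=> px xB; rewrite leNgt; apply/negP => lx.
  by move: xB; rewrite ltNge (ge_inf infB.2).
have adherent (E : set R) e : has_inf E -> 0 < e ->
    exists2 x, E x & inf E <= x < inf E + e.
  move=> iE e0; have [x Ex xe] := inf_adherent e0 iE.
  by exists x => //; rewrite xe (ge_inf iE.2).
exists (inf A), (inf B); split.
- rewrite pA /=; apply: lb_le_inf; first exact: infB.1.
  by move=> x [px lx]; apply: (ge_inf infA.2); split => //; exact: ltW.
- rewrite leNgt; apply/negP => /(ball_lt (hc _))[e e0 he].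
  have [x [_ lx] xe] := adherent _ _ infA e0.
  suff /he : ball (inf A) e x by rewrite ltNge lx.
  by rewrite /ball /= ltr_distlC; lra.
- move=> x /andP[px xA]; rewrite ltNge; apply/negP => lx.
  by move: xA; rewrite ltNge (ge_inf infA.2).
- move=> pB x /andP[px]; rewrite le_eqVlt => /predU1P[->|]; last exact: hB.
  rewrite leNgt; apply/negP => /(ball_gt (hc _))[e e0 he].
  (* A point of [[p, inf B[] within [e] of [inf B]: the maximum with [p] keeps it in range, and
     [p < inf B] keeps it strictly below [inf B]. *)
  have [y [yp ye yB]] : exists y, [/\ p <= y, inf B - e < y & y < inf B].
    exists (Num.max p (inf B - e / 2)).
    rewrite le_max lexx lt_max gt_max pB; split=> //=; last lra.
    by apply/orP; right; lra.
  suff /he : ball (inf B) e y by rewrite ltNge hB.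
  by rewrite /ball /= ltr_distlC; lra.
- move=> e e0; have [x [_ lx] xe] := adherent _ _ infB e0.
  by exists x.
Qed.

(** * Godunov fluxes at finite values *)

(** Merges the three cases of the flux: for [q < p] no [c] exists, for [q = p] only [l <= h p]
    remains, and for [p < q] the two conditions force the maximum to be [l]. *)
Lemma lower_godunovP (R : realType) (h : R -> R) (q p l : R) :
  lower_godunov h q p l%:E <->
  (exists2 c, p <= c <= q & l <= h c) /\
  (p < q -> forall t, p <= t <= q -> h t <= l).
Proof.
rewrite /lower_godunov; case: ltgtP => [qp|pq|->].
- split=> [//|[[c /andP[pc cq] _] _]].
  by have := le_lt_trans (le_trans pc cq) qp; rewrite ltxx.
- rewrite /max_on; split=> [[c /= [pcq hc] [<-]]|[[c pcq lc] /(_ isT) hl]].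
    rewrite in_itv /= in pcq; split; first by exists c.
    by move=> _ t ptq; apply: hc; rewrite /= in_itv.
  have hcl : h c = l by apply/eqP; rewrite eq_le lc hl.
  exists c; last by rewrite hcl.
  rewrite /= in_itv; split=> // t; rewrite /= in_itv /= hcl; exact: hl.
- rewrite /= lee_fin; split=> [lp|[[c] /le_anti <- //]].
  by split=> //; exists p; rewrite ?lexx.
Qed.

Lemma upper_godunov_reflect (R : realType) (h : R -> R) (q p l : R) :
  upper_godunov h q p l%:E <->
  lower_godunov (fun x => - h (- x)) (- q) (- p) (- l)%:E.
Proof.
rewrite /upper_godunov /lower_godunov ltrN2 eqr_opp.
case: ltgtP => [qp|pq|_].
- rewrite /min_on /max_on; split=> [[c /= [pcq hc] [<-]]|[c /= [pcq hc] [hl]]];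
    rewrite in_itv /= in pcq.
    exists (- c); last by rewrite opprK.
    split; first by rewrite /= in_itv /= !lerN2 andbC.
    move=> t; rewrite /= in_itv /= opprK lerN2 => /andP[pt tq].
    by apply: hc; rewrite in_itv /= lerNr tq lerNl.
  exists (- c); last by rewrite -[h _]opprK hl opprK.
  split; first by rewrite /= in_itv /= lerNr lerNl andbC.
  move=> t; rewrite /= in_itv /= => qtp.
  have := hc (- t); rewrite opprK lerN2; apply.
  by rewrite in_itv /= !lerN2 andbC.
- by [].
- by rewrite /= !lee_fin opprK lerN2.
Qed.

(** * The lower flux: value and existence *)

Lemma lower_godunov_value (R : realType) (N : nat) (H : 'I_N -> R -> R)
    (F : 'rV[R]_N -> R) (p q : 'rV[R]_N) :
  nonincreasing_each F ->
  (forall a, lower_godunov (H a) (q ord0 a) (p ord0 a) (F q)%:E) ->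
  (F q)%:E = lower_relax H F p.
Proof.
move=> Fni qG; apply/eqP; rewrite eq_le; apply/andP; split.
  have /choice[c cP] : forall a, exists c,
      p ord0 a <= c <= q ord0 a /\ F q <= H a c.
    by move=> a; have /lower_godunovP[[c ? ?] _] := qG a; exists c.
  have cE a : (\row_a c a) ord0 a = c a by rewrite mxE.
  apply: (@le_trans _ _ (Order.min (F (\row_a c a))%:E (Hmin H (\row_a c a)))).
    rewrite le_min lee_fin; apply/andP; split.
      apply: nonincreasing_le_vec => // a; rewrite cE.
      by have [/andP[]] := cP a.
    apply/bigmin_geP; split=> [|a _]; first by rewrite leey.
    by rewrite cE lee_fin; case: (cP a).
  apply: ereal_sup_ubound; exists (\row_a c a) => //= a.
  by rewrite cE; have [/andP[]] := cP a.
apply: ge_ereal_sup => _ [q' /= pq' <-].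
have [qq'|/existsNP[a /negP]] := pselect (le_vec q q').
  by rewrite ge_min lee_fin (nonincreasing_le_vec Fni).
rewrite -ltNge ge_min => q'q.
apply/orP; right; apply: (@le_trans _ _ (H a (q' ord0 a))%:E).
  exact: bigmin_le.
have /lower_godunovP[_ Hq] := qG a.
by rewrite lee_fin Hq ?(le_lt_trans _ q'q) ?pq' ?(ltW q'q).
Qed.

(* With [l] the supremum of [lower_relax] and [qa], [qb] the corners given by
   [level_interval] at level [l], one has [F qb <= l <= F qa]; the intermediate
   value theorem on the segment [qa, qb] yields [q] with [F q = l]. *)
Lemma lower_godunov_exists (R : realType) (N : nat) (H : 'I_N -> R -> R)
    (F : 'rV[R]_N -> R) (p : 'rV[R]_N) :
  (forall a, continuous (H a)) -> continuous F -> nonincreasing_each F ->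
  (forall a l, exists2 x, p ord0 a <= x & l < H a x) ->
  exists q : 'rV[R]_N,
    forall a, lower_godunov (H a) (q ord0 a) (p ord0 a) (F q)%:E.
Proof.
move=> Hc Fc Fni Hu.
(* The real levels lying below [min{F q, Hmin q}] for some [q >= p]; using them keeps the supremum
   in [R]. *)
pose S := [set l : R | exists2 q : 'rV[R]_N, le_vec p q &
  l <= F q /\ forall a, l <= H a (q ord0 a)].
have S0 : S !=set0.
  exists (\big[Num.min/F p]_a H a (p ord0 a)), p; first by move=> a.
  by split; [exact: bigmin_le_id | move=> a; exact: bigmin_le].
have supS : has_sup S.
  split=> //; exists (F p) => l [q pq [lq _]].
  exact: le_trans lq (nonincreasing_le_vec Fni pq).
set l := sup S.
have /choice[ab abP] : forall i, exists ab : R * R,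
    [/\ p ord0 i <= ab.1 <= ab.2, l <= H i ab.1,
    forall x, p ord0 i <= x < ab.1 -> H i x < l,
    p ord0 i < ab.2 -> forall x, p ord0 i <= x <= ab.2 -> H i x <= l &
    forall e, 0 < e -> exists2 x, ab.2 <= x < ab.2 + e & l < H i x].
  move=> i; have [a [b abP]] := level_interval (@Hc i) (Hu i l).
  by exists (a, b).
pose qa : 'rV[R]_N := \row_i (ab i).1.
pose qb : 'rV[R]_N := \row_i (ab i).2.
have Fqb : F qb <= l.
  (* Otherwise move each coordinate of [qb] right by less than [e] to a point where [H i > l]. There
     [F > l] still holds, so [S] contains a level above [l]. *)
  rewrite leNgt; apply/negP => /(ball_gt (Fc _))[e e0 Fe].
  have /choice[x xP] : forall i, exists x,
      (ab i).2 <= x < (ab i).2 + e /\ l < H i x.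
    move=> i; have [_ _ _ _ /(_ e e0)[x ? ?]] := abP i; by exists x.
  have Fx : l < F (\row_i x i).
    apply: Fe; split=> // i j; rewrite !mxE /ball /= ltr_distlC.
    by have [/andP[? ?] _] := xP j; apply/andP; split; lra.
  have : l < \big[Num.min/F (\row_i x i)]_i H i (x i).
    by apply: lt_bigmin => // i _; case: (xP i).
  rewrite ltNge => /negP; apply; apply: (sup_upper_bound supS).
  exists (\row_i x i).
    move=> i; rewrite mxE; have [/andP[bx _] _] := xP i.
    have [/andP[pa ab'] _ _ _ _] := abP i.
    exact: le_trans pa (le_trans ab' bx).
  split=> [|i]; first exact: bigmin_le_id.
  by rewrite mxE; apply: (bigmin_le _ i).
have Fqa : l <= F qa.
  (* Otherwise shift [qa] left to [x >= p], keeping [F x < l]. Each [q >= p] either dominates [x],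
     or has a coordinate below that of [x], where [H i <= m i < l]; so [S] is bounded by a number
     below [l]. *)
  rewrite leNgt; apply/negP => /(ball_lt (Fc _))[e e0 Fe].
  pose x : 'rV[R]_N := \row_i Num.max (p ord0 i) ((ab i).1 - e / 2).
  have Fx : F x < l.
    apply: Fe; split=> // i j; rewrite !mxE /ball /= ltr_distlC.
    have [/andP[pa _] _ _ _ _] := abP j.
    by rewrite lt_max gt_max; apply/andP; split; [apply/orP; right|]; lra.
  have /choice[m mP] : forall i, exists m, m < l /\
      forall y, p ord0 i <= y < x ord0 i -> H i y <= m.
    move=> i; have [/andP[pa _] _ al _ _] := abP i.
    have px : p ord0 i <= x ord0 i by rewrite mxE le_max lexx.
    have [xa|ax] := ltP (x ord0 i) (ab i).1.
      have [c] := EVT_max px (continuous_subspaceT (@Hc i)).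
      rewrite in_itv /= => /andP[pc cx] cP; exists (H i c).
      split; first by apply: al; rewrite pc (le_lt_trans cx xa).
      by move=> y /andP[py yx]; apply: cP; rewrite in_itv /= py ltW.
    (* Here [x] and [p] agree in coordinate [i], so no [y] qualifies and any number below [l]
       serves. *)
    exists (l - 1); split; first lra.
    move=> y /andP[py]; rewrite mxE lt_max => /orP[|ya]; first by rewrite ltNge py.
    by move: ax; rewrite mxE le_max => /orP[]; lra.
  have : \big[Num.max/F x]_i m i < l by apply: bigmax_lt => // i _; case: (mP i).
  rewrite ltNge => /negP; apply; apply: ge_sup => // k [q pq [kF kH]].
  have [xq|/existsNP[i /negP]] := pselect (le_vec x q).
    apply: (le_trans kF); apply: (le_trans (nonincreasing_le_vec Fni xq)).
    exact: bigmax_ge_id.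
  rewrite -ltNge => qx; apply: (le_trans (kH i)).
  apply: (@le_trans _ _ (m i)); last exact: le_bigmax.
  by apply: (mP i).2; rewrite pq.
pose g (t : R) := F (qa + t *: (qb - qa)).
have gc : continuous g.
  move=> t; apply: (@continuous_comp _ _ _ (fun t : R => qa + t *: (qb - qa)) F);
    last exact: Fc.
  apply: cvgD; first exact: cvg_cst.
  exact: scalel_continuous.
have g0 : g 0 = F qa by rewrite /g scale0r addr0.
have g1 : g 1 = F qb by rewrite /g scale1r addrC subrK.
have [|t] := @IVT _ g 0 1 l ler01 (continuous_subspaceT gc).
  by rewrite g0 g1 ge_min le_max Fqa Fqb orbT.
rewrite in_itv /= => /andP[t0 t1] gt; exists (qa + t *: (qb - qa)) => i.
rewrite -/(g t) gt !mxE; have [/andP[pa ab'] la al bl _] := abP i.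
set u := (ab i).1 in pa ab' la al *; set v := (ab i).2 in ab' bl *.
(* The coordinate stays in [[u, v]]: it is beyond [u], where [H i >= l], and up to [v] one has
   [H i <= l]. *)
have uw : u <= u + t * (v - u) by rewrite lerDl mulr_ge0 ?subr_ge0.
have wv : u + t * (v - u) <= v by nra.
apply/lower_godunovP; split; first by exists u => //; rewrite pa.
move=> pw s /andP[ps sw]; apply: bl; first exact: lt_le_trans wv.
by rewrite ps (le_trans sw).
Qed.
(* When [F] tends to [-oo] instead of [H a], raise [H a] to [max (H a) (id - K)]
   with [K] so large that nothing changes on [p, B], and [B] so large that the
   point found for the modified Hamiltonians lies below [B]. *)
Lemma lower_godunov_exists_flux (R : realType) (N : nat) (H : 'I_N -> R -> R)
    (F : 'rV[R]_N -> R) (p : 'rV[R]_N) :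
  (forall a, continuous (H a)) -> continuous F -> nonincreasing_each F ->
  (forall A, exists B, forall q : 'rV[R]_N, forall a, B < q ord0 a -> F q < A) ->
  exists q : 'rV[R]_N,
    forall a, lower_godunov (H a) (q ord0 a) (p ord0 a) (F q)%:E.
Proof.
move=> Hc Fc Fni Foo.
(* The level obtained by testing the relaxation at [p] itself. Raising the Hamiltonians preserves
   this lower bound, while [F < m] once a coordinate exceeds [B]. *)
pose m := \big[Num.min/F p]_a H a (p ord0 a).
have [B FB] := Foo m.
have /choice[K KP] : forall a, exists K,
    forall x, p ord0 a <= x <= B -> x - K <= H a x.
  move=> a; have [pB|Bp] := leP (p ord0 a) B; last first.
    by exists 0 => x /andP[px xB]; have := lt_le_trans Bp (le_trans px xB);
      rewrite ltxx.
  have [c _ cP] := EVT_min pB (continuous_subspaceT (@Hc a)).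
  (* With this [K], [x - K <= H a c] for [x <= B], and [H a c] is the minimum on [[p, B]]. *)
  exists (B - H a c) => x /andP[px xB].
  have : H a c <= H a x by apply: cP; rewrite in_itv /= px.
  by lra.
pose H' a x := Num.max (H a x) (x - K a).
have H'E a x : p ord0 a <= x <= B -> H' a x = H a x.
  by move=> /KP; rewrite /H' => /max_idPl.
have [|//|//||q qG] := @lower_godunov_exists R N H' F p.
- move=> a x; apply: (@continuous_max _ _ (H a) (fun x => x - K a)).
    exact: Hc.
  by apply: continuousB => //; exact: cst_continuous.
- move=> a l; exists (Num.max (p ord0 a) (K a + l + 1)).
    by rewrite le_max lexx.
  rewrite /H' lt_max ltrBrDr lt_max; apply/orP; right; apply/orP; right; lra.
have mF : m <= F q.
  rewrite -lee_fin (lower_godunov_value Fni qG).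
  apply: (@le_trans _ _ (Order.min (F p)%:E (Hmin H' p))); last first.
    by apply: ereal_sup_ubound; exists p => //= a.
  rewrite le_min lee_fin bigmin_le_id /=; apply/bigmin_geP.
  split=> [|a _]; first by rewrite leey.
  by rewrite lee_fin le_max; apply/orP; left; exact: bigmin_le.
have qB a : q ord0 a <= B.
  by rewrite leNgt; apply/negP => /FB; rewrite ltNge mF.
exists q => a; have /lower_godunovP[[c /andP[pc cq] Fc'] Hq] := qG a.
apply/lower_godunovP; split.
  by exists c; rewrite ?pc // -H'E // pc (le_trans cq).
move=> pq t /andP[pt tq].
by rewrite -H'E ?pt ?(le_trans tq) // Hq // pt.
Qed.

(** * Reflection and the two identities *)

Lemma upper_relax_reflect (R : realType) (N : nat) (H : 'I_N -> R -> R)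
    (F : 'rV[R]_N -> R) (p : 'rV[R]_N) :
  upper_relax H F p =
  (- lower_relax (fun a x => - H a (- x))%R (fun q => - F (- q))%R (- p)%R)%E.
Proof.
have HmaxN q : Hmax H q = (- Hmin (fun a x => - H a (- x))%R (- q)%R)%E.
  rewrite /Hmin /coord_min (big_morph _ (@oppe_min R) (erefl : (- +oo = -oo)%E)).
  by apply: eq_bigr => a _; rewrite mxE EFinN oppeK opprK.
rewrite /upper_relax /lower_relax /ereal_inf; congr (- ereal_sup _)%E.
apply/seteqP; split=> [_ [_ [q /= qp <-] <-]|_ [q /= qp <-]].
  exists (- q); first by move=> a; rewrite !mxE lerN2.
  by rewrite oppe_max HmaxN oppeK opprK EFinN.
exists (Order.max (F (- q))%:E (Hmax H (- q))).
  by exists (- q) => // a; have := qp a; rewrite !mxE lerNl.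
by rewrite oppe_max HmaxN oppeK opprK EFinN.
Qed.

Theorem proposition4p1 (R : realType) (N : nat) (N_ge1 : (1 <= N)%N)
    (H : 'I_N -> R -> R)
    (H_cont : forall a : 'I_N, continuous (H a))
    (H_coercive : forall a : 'I_N, coercive (H a))
    (F0 : 'rV[R]_N -> R)
    (F0_cont : continuous F0)
    (F0_noninc : nonincreasing_each F0)
    (F0_semi : semi_coercive F0) :
  (forall p : 'rV[R]_N,
     godunov_values (fun a : 'I_N => lower_godunov (H a)) F0 p
     = [set lower_relax H F0 p]) /\
  (forall p : 'rV[R]_N,
     godunov_values (fun a : 'I_N => upper_godunov (H a)) F0 p
     = [set upper_relax H F0 p]).
Proof.
split=> p; apply/seteqP; split=> [_ [q /= qG <-]|_ -> /=].
- exact: lower_godunov_value.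
- have [|q qG] := lower_godunov_exists (p := p) H_cont F0_cont F0_noninc.
    move=> a l; have [B HB] := H_coercive a l.
    exists (Num.max (p ord0 a) (Num.max B 0 + 1)).
      by rewrite le_max lexx.
    apply: HB; apply: lt_le_trans (ler_norm _).
    have : B <= Num.max B 0 by rewrite le_max lexx.
    by rewrite lt_max => BB; apply/orP; right; lra.
  by exists q => //; exact: lower_godunov_value.
- rewrite upper_relax_reflect -(@lower_godunov_value _ _ _ _ _ (- q)).
  + by rewrite opprK EFinN oppeK.
  + exact: nonincreasing_reflect.
  + move=> a; rewrite !mxE opprK; exact/upper_godunov_reflect.
- have [||||q qG] := @lower_godunov_exists_flux R N (fun a x => - H a (- x))
    (fun q => - F0 (- q)) (- p).
  + move=> a x; apply: continuousN; apply: continuous_comp; last exact: H_cont.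
    exact: oppr_continuous.
  + move=> x; apply: continuousN; apply: continuous_comp; last exact: F0_cont.
    exact: oppr_continuous.
  + exact: nonincreasing_reflect.
  (* A coordinate of [q] above [- B] puts the smallest coordinate of [- q] below [B], so
     semi-coercivity gives [F0 (- q) > - A]. *)
  + move=> A; have [B FB] := F0_semi (- A); exists (- B) => q a Bq.
    rewrite ltrNl; apply: FB.
    apply: le_lt_trans (bigmin_le _ a _) _.
    by rewrite lte_fin mxE ltrNl.
  rewrite upper_relax_reflect -(lower_godunov_value _ qG);
    last exact: nonincreasing_reflect.
  exists (- q); last by rewrite EFinN oppeK.
  move=> a; apply/upper_godunov_reflect; have := qG a.
  by rewrite !mxE opprK.
Qed.
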